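(* Let $P$ be a convex polygon in $\mathbb{R}^2$ and let $x\in\mathbb{R}^2$. If a point $y\in P$ has maximal distance from $x$ among all points of $P$, then $y$ is a vertex of $P$.
   Context: A convex polygon $P$ is understood as the closed polygonal curve (union of its edges) which is the boundary of a compact convex region with nonempty interior. Distances are Euclidean. *)

(* Defs.v *)
From mathcomp Require Import all_boot all_order all_algebra.
From mathcomp Require Import all_classical all_reals all_analysis.
Set Implicit Arguments.
Unset Strict Implicit.
Unset Printing Implicit Defensive.
Import Order.TTheory GRing.Theory Num.Theory.
Import numFieldNormedType.Exports.
Local Open Scope classical_set_scope.
Local Open Scope ring_scope.

(* The norm of the library on 'rV[R]_2 is the sup norm; it induces the usual
   topology, but Euclidean distances have to be defined separately. *)
Definition eucl_dist (R : realType) (p q : 'rV[R]_2) : R :=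
  Num.sqrt (\sum_(j < 2) (p 0 j - q 0 j) ^+ 2).

Definition segment (R : realType) (a b : 'rV[R]_2) : set 'rV[R]_2 :=
  [set (1 - t) *: a + t *: b | t in `[0, 1]].

Definition collinear (R : realType) (a b c : 'rV[R]_2) : Prop :=
  exists p u : 'rV[R]_2, forall q, q \in [:: a; b; c] ->
    exists t : R, q = p + t *: u.

Definition boundary (T : topologicalType) (K : set T) : set T :=
  closure K `\` interior K.

Definition closed_polyline (R : realType) (n : nat) (v : 'I_n -> 'rV[R]_2) :
    set 'rV[R]_2 :=
  \bigcup_(i in [set: 'I_n]) segment (v i) (v (ordS i)).

(* The vertices are listed in cyclic order. They are distinct and none of them
   is flat, i.e. consecutive edges are never aligned. Then v lists exactly the
   corners of the region, and the edges, which make up its boundary, are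
   automatically non-crossing. *)
Record convex_polygon (R : realType) := ConvexPolygon {
  nvert : nat;
  vertex : 'I_nvert -> 'rV[R]_2;
  nvert_ge3 : (3 <= nvert)%N;
  vertex_inj : injective vertex;
  vertex_corner : forall i : 'I_nvert,
    ~ collinear (vertex (ord_pred i)) (vertex i) (vertex (ordS i));
  polygon_convex : exists K : set 'rV[R]_2,
    [/\ compact K, convex_set K, interior K !=set0 &
        closed_polyline vertex = boundary K]
}.

Definition polygon_points (R : realType) (P : convex_polygon R) :
    set 'rV[R]_2 :=
  closed_polyline (vertex (c := P)).

Definition is_vertex (R : realType) (P : convex_polygon R) (y : 'rV[R]_2) :
    Prop :=
  exists i : 'I_(nvert P), y = vertex i.

(* Main.v *)
(** For [p = (1 - t) a + t b] on an edge,
    [|x - p|^2 = (1 - t) |x - a|^2 + t |x - b|^2 - t (1 - t) |a - b|^2].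
    If [p] is at least as far from [x] as [a] and [b] are, then
    [t (1 - t) |a - b|^2 <= 0], so [p] is an endpoint of the edge. *)
Require Import Defs.
From mathcomp Require Import all_boot all_order all_algebra.
From mathcomp Require Import all_classical all_reals all_analysis.
From mathcomp Require Import lra.
Set Implicit Arguments.
Unset Strict Implicit.
Unset Printing Implicit Defensive.
Import Order.TTheory GRing.Theory Num.Theory.
Local Open Scope ring_scope.

(** Comparing squares removes the roots and leaves polynomials in the coordinates, a form suited to
    [lra]. *)
Lemma le_eucl_dist (R : realType) (x p q : 'rV[R]_2) :
  (eucl_dist x p <= eucl_dist x q) =
  (\sum_(j < 2) (x 0 j - p 0 j) ^+ 2 <= \sum_(j < 2) (x 0 j - q 0 j) ^+ 2).
Proof. by rewrite ler_sqrt// sumr_ge0// => j _; exact: sqr_ge0. Qed.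

Lemma segment_left (R : realType) (a b : 'rV[R]_2) : segment a b a.
Proof.
by exists 0; rewrite ?subr0 ?scale1r ?scale0r ?addr0//= in_itv/= lexx ler01.
Qed.

Lemma segment_right (R : realType) (a b : 'rV[R]_2) : segment a b b.
Proof.
by exists 1; rewrite ?subrr ?scale1r ?scale0r ?add0r//= in_itv/= lexx ler01.
Qed.

Lemma segment_farthest (R : realType) (x a b p : 'rV[R]_2) :
  segment a b p ->
  eucl_dist x a <= eucl_dist x p -> eucl_dist x b <= eucl_dist x p ->
  p = a \/ p = b.
Proof.
case=> t /=; rewrite in_itv/= => /andP[t0 t1] <-.
(* The endpoints are split off so that [t * (1 - t)] is positive in what remains and can be
   cancelled. *)
have [->|tn0] := eqVneq t 0.
  by left; rewrite subr0 scale1r scale0r addr0.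
have [->|tn1] := eqVneq t 1.
  by right; rewrite subrr scale1r scale0r add0r.
have {tn0}t_gt0 : 0 < t by rewrite lt0r tn0.
have {t1 tn1}t_lt1 : 0 < 1 - t by rewrite subr_gt0 lt_neqAle tn1.
rewrite !le_eucl_dist => xa xb.
have ab_le0 : t * (1 - t) * (\sum_(j < 2) (a 0 j - b 0 j) ^+ 2) <= 0.
  (* With the weights [1 - t] and [t] the right-hand sides add up to the squared distance from [x]
     to the point of the segment. Once expanded in coordinates, the claim is linear in the
     monomials. *)
  move: (ler_wpM2l (ltW t_lt1) xa) (ler_wpM2l t0 xb).
  rewrite !big_ord_recl !big_ord0 !mxE.
  by lra.
have {ab_le0} : \sum_(j < 2) (a 0 j - b 0 j) ^+ 2 == 0.
  rewrite eq_le sumr_ge0 ?andbT => [|j _]; last exact: sqr_ge0.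
  by move: ab_le0; rewrite pmulr_rle0// mulr_gt0.
rewrite psumr_eq0 => [/allP ab0|j _]; last exact: sqr_ge0.
(* An interior parameter thus survives only on a degenerate segment, whose single point is [a]. *)
have -> : a = b.
  apply/rowP => j; apply/eqP; rewrite -subr_eq0 -sqrf_eq0.
  exact/ab0/mem_index_enum.
by left; rewrite -scalerDl subrK scale1r.
Qed.

Theorem lemma4p1 (R : realType) (P : convex_polygon R) (x y : 'rV[R]_2) :
  polygon_points P y ->
  (forall z : 'rV[R]_2, polygon_points P z -> eucl_dist x z <= eucl_dist x y) ->
  is_vertex P y.
Proof.
case=> i _ yi ymax.
have edgeP z : segment (vertex i) (vertex (ordS i)) z -> polygon_points P z.
  by exists i.
(* Maximality of [y] is applied only at the two ends of an edge through [y]. *)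
have [->|->] := segment_farthest yi (ymax _ (edgeP _ (segment_left _ _)))
                                 (ymax _ (edgeP _ (segment_right _ _))).
- by exists i.
- by exists (ordS i).
Qed.
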